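(* Let $\mathcal{X}=(M\xrightarrow{\partial}N,\cdot,\{-,-\})$ be a braided crossed module of Lie $K$-algebras such that $(M\xrightarrow{\partial}N,\cdot)$ is a perfect crossed module of Lie $K$-algebras. Let $\mathcal{V}=(N\otimes M\xrightarrow{\mathrm{Id}_N\otimes\partial}N\otimes N,*,\langle\!\langle-,-\rangle\!\rangle)$ and let $c=(c_1,c_2)\colon\mathcal{V}\to\mathcal{X}$ be given by $c_1(n\otimes m)=n\cdot m$ and $c_2(n\otimes n')=[n,n']$. Then $c\colon\mathcal{V}\to\mathcal{X}$ is the universal compatible central extension of $\mathcal{X}$: it is a compatible central extension, and for every compatible central extension $f\colon(X_1\xrightarrow{\delta}X_2,\diamond,\langle-,-\rangle)\to\mathcal{X}$ there exists a unique morphism of braided crossed modules $h=(h_1,h_2)\colon\mathcal{V}\to(X_1\xrightarrow{\delta}X_2,\diamond,\langle-,-\rangle)$ such that $c=f\circ h$. In addition, $h$ is the same morphism as in the non-braided case, i.e. it is the unique morphism of crossed modules $(N\otimes M\xrightarrow{\mathrm{Id}_N\otimes\partial}N\otimes N,* )\to(X_1\xrightarrow{\delta}X_2,\diamond)$ with $c=f\circ h$.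
   Context: $K$ is a fixed field; all Lie algebras and Lie homomorphisms are over $K$. A crossed module of Lie algebras $(M\xrightarrow{\partial}N,\cdot)$ consists of a Lie action of $N$ on $M$, i.e. a $K$-bilinear map $\cdot\colon N\times M\to M$ with $[n,n']\cdot m=n\cdot(n'\cdot m)-n'\cdot(n\cdot m)$ and $n\cdot[m,m']=[n\cdot m,m']+[m,n\cdot m']$, and a Lie homomorphism $\partial\colon M\to N$ with $\partial(n\cdot m)=[n,\partial(m)]$ and $\partial(m)\cdot m'=[m,m']$. A morphism of crossed modules from $(M\xrightarrow{\partial}N,\cdot)$ to $(L\xrightarrow{\delta}H,* )$ is a pair of Lie homomorphisms $f_1\colon M\to L$, $f_2\colon N\to H$ with $f_1(n\cdot m)=f_2(n)*f_1(m)$ and $\delta\circ f_1=f_2\circ\partial$. A braiding on $(M\xrightarrow{\partial}N,\cdot)$ is a $K$-bilinear map $\{-,-\}\colon N\times N\to M$ such that, for all $m,m'\in M$, $n,n',n''\in N$: $\partial\{n,n'\}=[n,n']$; $\{\partial m,\partial m'\}=[m,m']$; $\{\partial m,n\}=-n\cdot m$; $\{n,\partial m\}=n\cdot m$; $\{n,[n',n'']\}=\{[n,n'],n''\}-\{[n,n''],n'\}$; $\{[n,n'],n''\}=\{n,[n',n'']\}-\{n',[n,n'']\}$. A morphism of braided crossed modules is a morphism of crossed modules $(f_1,f_2)$ which carries the braiding $\{-,-\}$ of the domain to the braiding $\langle-,-\rangle$ of the codomain: $f_1(\{n,n'\})=\langle f_2(n),f_2(n')\rangle$. For a crossed module $(M\xrightarrow{\partial}N,\cdot)$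 put $M^N=\{m\in M\mid n\cdot m=0\ \forall n\in N\}$, $\mathrm{st}_N(M)=\{n\in N\mid n\cdot m=0\ \forall m\in M\}$, $Z(N)$ the center of $N$, and $D_N(M)$ the Lie subalgebra of $M$ generated by all $n\cdot m$. The crossed module is perfect if $M=D_N(M)$ and $N=[N,N]$. An extension of braided crossed modules is a morphism $(f_1,f_2)$ with $f_1,f_2$ surjective; an extension with domain $(M\xrightarrow{\partial}N,\cdot,\{-,-\})$ is a compatible central extension if it is central as an extension of crossed modules, i.e. $\ker(f_1)\subset M^N$ and $\ker(f_2)\subset\mathrm{st}_N(M)\cap Z(N)$. Non-abelian tensor product: let $A,B$ be Lie algebras with $A$ acting on $B$ (written $a\cdot b$) and $B$ acting on $A$ (written $b\star a$). $A\otimes B$ is the Lie $K$-algebra generated by symbols $a\otimes b$ subject to: $K$-bilinearity of $(a,b)\mapsto a\otimes b$; $[a,a']\otimes b=a\otimes(a'\cdot b)-a'\otimes(a\cdot b)$; $a\otimes[b,b']=(b'\star a)\otimes b-(b\star a)\otimes b'$; $[a\otimes b,a'\otimes b']=-(b\star a)\otimes(a'\cdot b')$. $N\otimes N$ is formed with the adjoint actions of $N$ on itself. $N\otimes M$ is formed with the given action of $N$ on $M$ and the action $m\star n=[\partial(m),n]$ of $M$ on $N$. The crossed module $(N\otimes M\xrightarrow{\mathrm{Id}_N\otimes\partial}N\otimes N,* )$ has $(\mathrm{Id}_N\otimes\partial)(n\otimes m)=n\otimes\partial(m)$ and action $(n\otimes n')*(n''\otimes m)=[[n,n'],n'']\otimes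 m+n''\otimes([n,n']\cdot m)$; its braiding $\langle\!\langle-,-\rangle\!\rangle$ is the $K$-bilinear map with $\langle\!\langle n\otimes n',n''\otimes n'''\rangle\!\rangle=[n,n']\otimes\{n'',n'''\}$. *)

(* Defs.v *)
From HB Require Import structures.
From mathcomp Require Import all_boot all_algebra.
From mathcomp Require Import boolp.

Set Implicit Arguments.
Unset Strict Implicit.
Unset Printing Implicit Defensive.

Import GRing.Theory.
Local Open Scope ring_scope.
Local Open Scope quotient_scope.

HB.mixin Record Lmodule_isLieAlgebra (K : fieldType) L of GRing.Lmodule K L := {
  lie : L -> L -> L;
  lie_linearl : forall (k : K) (x x' y : L),
    lie (k *: x + x') y = k *: lie x y + lie x' y;
  lie_linearr : forall (k : K) (x y y' : L),
    lie x (k *: y + y') = k *: lie x y + lie x y';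
  liexx : forall x : L, lie x x = 0;
  lie_jacobi : forall x y z : L,
    lie x (lie y z) + lie y (lie z x) + lie z (lie x y) = 0
}.

#[short(type="lieAlgType")]
HB.structure Definition LieAlgebra (K : fieldType) :=
  {L of GRing.Lmodule K L & Lmodule_isLieAlgebra K L}.

Notation "⟦ x , y ⟧" := (lie x y) (at level 0, format "⟦ x ,  y ⟧") : ring_scope.

Section Basics.
Variable K : fieldType.

Definition bilin (U V W : lmodType K) (f : U -> V -> W) : Prop :=
  (forall v, linear (f^~ v)) /\ (forall u, linear (f u)).

Definition lie_hom (L L' : lieAlgType K) (f : L -> L') : Prop :=
  linear f /\ {morph f : x y / ⟦x, y⟧}.

Definition subspace (V : lmodType K) (Q : V -> Prop) : Prop :=
  Q 0 /\ forall (k : K) u v, Q u -> Q v -> Q (k *: u + v).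

Definition lie_subalgebra (L : lieAlgType K) (Q : L -> Prop) : Prop :=
  subspace Q /\ forall x y, Q x -> Q y -> Q ⟦x, y⟧.

Definition lie_subalgebra_gen (L : lieAlgType K) (S : L -> Prop) (x : L) :
  Prop := forall Q, lie_subalgebra Q -> (forall y, S y -> Q y) -> Q x.

(* [L, L], the linear span of all brackets *)
Definition derived (L : lieAlgType K) (x : L) : Prop :=
  forall Q : L -> Prop, subspace Q -> (forall y z, Q ⟦y, z⟧) -> Q x.

Definition lie_center (L : lieAlgType K) (z : L) : Prop :=
  forall x, ⟦z, x⟧ = 0.

Section Linear.
Variables (U V : lmodType K) (f : U -> V) (lf : linear f).
Lemma linr0 : f 0 = 0.
Proof. by have := lf (- 1) 0 0; rewrite scaler0 addr0 scaleN1r addNr. Qed.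
Lemma linrD u v : f (u + v) = f u + f v.
Proof. by have := lf 1 u v; rewrite !scale1r. Qed.
Lemma linrZ k u : f (k *: u) = k *: f u.
Proof. by have := lf k u 0; rewrite linr0 !addr0. Qed.
Lemma linrN u : f (- u) = - f u.
Proof. by rewrite -scaleN1r linrZ scaleN1r. Qed.
Lemma linrB u v : f (u - v) = f u - f v.
Proof. by rewrite linrD linrN. Qed.
End Linear.

Section LieTheory.
Variable L : lieAlgType K.
Implicit Types x y z : L.
Lemma lie_bilin : bilin (@lie K L).
Proof. by split=> [v k x x'|u k y y']; rewrite ?lie_linearl ?lie_linearr. Qed.
Definition lie0l x := linr0 (lie_bilin.1 x).
Definition lie0r x := linr0 (lie_bilin.2 x).
Definition lieDl x y z := linrD (lie_bilin.1 x) y z.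
Definition lieDr x y z := linrD (lie_bilin.2 x) y z.
Definition lieNl x y := linrN (lie_bilin.1 x) y.
Definition lieNr x y := linrN (lie_bilin.2 x) y.
Definition lieZl x k y := linrZ (lie_bilin.1 x) k y.
Definition lieZr x k y := linrZ (lie_bilin.2 x) k y.
Lemma lieC x y : ⟦x, y⟧ = - ⟦y, x⟧.
Proof.
apply/eqP; rewrite -addr_eq0; apply/eqP.
by have := liexx (x + y); rewrite lieDl !lieDr !liexx add0r addr0.
Qed.
Lemma lie_der x y z : ⟦⟦x, y⟧, z⟧ = ⟦x, ⟦y, z⟧⟧ - ⟦y, ⟦x, z⟧⟧.
Proof.
have := lie_jacobi x y z; move/eqP; rewrite addr_eq0 => /eqP E.
by rewrite [LHS]lieC -E (lieC z x) lieNr.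
Qed.
End LieTheory.

End Basics.

(* The Lie algebra presented by generators X and relations R: formal terms
   modulo the smallest congruence containing R and the Lie algebra axioms. *)

Inductive lie_term (K X : Type) : Type :=
  | Tgen of X
  | Tzero
  | Tadd of lie_term K X & lie_term K X
  | Topp of lie_term K X
  | Tscale of K & lie_term K X
  | Tlie of lie_term K X & lie_term K X.
Arguments Tgen {K X}.
Arguments Tzero {K X}.

HB.instance Definition _ (K X : Type) := gen_eqMixin (lie_term K X).
HB.instance Definition _ (K X : Type) := gen_choiceMixin (lie_term K X).

Inductive lie_cong (K : fieldType) (X : Type)
    (R : lie_term K X -> lie_term K X -> Prop) :
    lie_term K X -> lie_term K X -> Prop :=
  | Crel s t : R s t -> lie_cong R s t
  | Crefl t : lie_cong R t t
  | Csym s t : lie_cong R s t -> lie_cong R t s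
  | Ctrans s t u : lie_cong R s t -> lie_cong R t u -> lie_cong R s u
  | CaddM s s' t t' : lie_cong R s s' -> lie_cong R t t' ->
      lie_cong R (Tadd s t) (Tadd s' t')
  | CoppM s s' : lie_cong R s s' -> lie_cong R (Topp s) (Topp s')
  | CscaleM k s s' : lie_cong R s s' -> lie_cong R (Tscale k s) (Tscale k s')
  | ClieM s s' t t' : lie_cong R s s' -> lie_cong R t t' ->
      lie_cong R (Tlie s t) (Tlie s' t')
  | CaddA s t u : lie_cong R (Tadd s (Tadd t u)) (Tadd (Tadd s t) u)
  | CaddC s t : lie_cong R (Tadd s t) (Tadd t s)
  | Cadd0 t : lie_cong R (Tadd Tzero t) t
  | CaddN t : lie_cong R (Tadd (Topp t) t) Tzero
  | CscaleA k l t : lie_cong R (Tscale k (Tscale l t)) (Tscale (k * l) t)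
  | Cscale1 t : lie_cong R (Tscale 1 t) t
  | CscaleDr k s t :
      lie_cong R (Tscale k (Tadd s t)) (Tadd (Tscale k s) (Tscale k t))
  | CscaleDl k l t :
      lie_cong R (Tscale (k + l) t) (Tadd (Tscale k t) (Tscale l t))
  | Clinl k s s' t : lie_cong R (Tlie (Tadd (Tscale k s) s') t)
      (Tadd (Tscale k (Tlie s t)) (Tlie s' t))
  | Clinr k s t t' : lie_cong R (Tlie s (Tadd (Tscale k t) t'))
      (Tadd (Tscale k (Tlie s t)) (Tlie s t'))
  | Calt t : lie_cong R (Tlie t t) Tzero
  | Cjac s t u : lie_cong R
      (Tadd (Tadd (Tlie s (Tlie t u)) (Tlie t (Tlie u s))) (Tlie u (Tlie s t)))
      Tzero.

Section Presentation.
Variables (K : fieldType) (X : Type) (R : lie_term K X -> lie_term K X -> Prop).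
Local Notation term := (lie_term K X).

Definition lie_congb (s t : term) : bool := `[< lie_cong R s t >].

Lemma lie_congb_equiv : equiv_class_of lie_congb.
Proof.
split=> [t|s t|t s u].
- by apply/asboolP; apply: Crefl.
- by apply/asboolP/asboolP; apply: Csym.
- by move=> /asboolP st /asboolP tu; apply/asboolP; apply: Ctrans st tu.
Qed.

Canonical lie_cong_equiv := EquivRelPack lie_congb_equiv.

Definition lie_pres : Type := {eq_quot lie_cong_equiv}.

HB.instance Definition _ := Choice.on lie_pres.
HB.instance Definition _ := EqQuotient.on lie_pres.

Local Notation cls := (\pi_lie_pres).

Lemma clsP s t : cls s = cls t <-> lie_cong R s t.
Proof.
by split=> [/eqmodP /asboolP | st] //; apply/eqmodP/asboolP.
Qed.

Definition lp_zero : lie_pres := cls Tzero.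
Definition lp_add (x y : lie_pres) : lie_pres := cls (Tadd (repr x) (repr y)).
Definition lp_opp (x : lie_pres) : lie_pres := cls (Topp (repr x)).
Definition lp_scale (k : K) (x : lie_pres) : lie_pres :=
  cls (Tscale k (repr x)).
Definition lp_lie (x y : lie_pres) : lie_pres := cls (Tlie (repr x) (repr y)).

Lemma repr_cls t : lie_cong R (repr (cls t)) t.
Proof. by apply/clsP; rewrite reprK. Qed.

Lemma lp_addE s t : lp_add (cls s) (cls t) = cls (Tadd s t).
Proof. by apply/clsP; apply: CaddM; apply: repr_cls. Qed.
Lemma lp_oppE s : lp_opp (cls s) = cls (Topp s).
Proof. by apply/clsP; apply: CoppM; apply: repr_cls. Qed.
Lemma lp_scaleE k s : lp_scale k (cls s) = cls (Tscale k s).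
Proof. by apply/clsP; apply: CscaleM; apply: repr_cls. Qed.
Lemma lp_lieE s t : lp_lie (cls s) (cls t) = cls (Tlie s t).
Proof. by apply/clsP; apply: ClieM; apply: repr_cls. Qed.

Fact lp_addA : associative lp_add.
Proof.
elim/quotW=> s; elim/quotW=> t; elim/quotW=> u.
by rewrite (lp_addE t u) (lp_addE s t) !lp_addE; apply/clsP; constructor.
Qed.
Fact lp_addC : commutative lp_add.
Proof.
by elim/quotW=> s; elim/quotW=> t; rewrite !lp_addE; apply/clsP; constructor.
Qed.
Fact lp_add0 : left_id lp_zero lp_add.
Proof. by elim/quotW=> s; rewrite lp_addE; apply/clsP; constructor. Qed.
Fact lp_addN : left_inverse lp_zero lp_opp lp_add.
Proof. by elim/quotW=> s; rewrite lp_oppE lp_addE; apply/clsP; constructor. Qed.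

HB.instance Definition _ :=
  GRing.isZmodule.Build lie_pres lp_addA lp_addC lp_add0 lp_addN.

Fact lp_scaleA k l x : lp_scale k (lp_scale l x) = lp_scale (k * l) x.
Proof. by elim/quotW: x => s; rewrite (lp_scaleE l) !lp_scaleE; apply/clsP; constructor. Qed.
Fact lp_scale1 : left_id 1 lp_scale.
Proof. by elim/quotW=> s; rewrite lp_scaleE; apply/clsP; constructor. Qed.
Fact lp_scaleDr : right_distributive lp_scale lp_add.
Proof.
move=> k; elim/quotW=> s; elim/quotW=> t.
by rewrite (lp_addE s t) !lp_scaleE lp_addE; apply/clsP; constructor.
Qed.
Fact lp_scaleDl x : {morph lp_scale^~ x : k l / k + l >-> lp_add k l}.
Proof.
by elim/quotW: x => s k l; rewrite !lp_scaleE lp_addE; apply/clsP; constructor. Qed.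

HB.instance Definition _ := GRing.Zmodule_isLmodule.Build K lie_pres
  lp_scaleA lp_scale1 lp_scaleDr lp_scaleDl.

Fact lp_linl (k : K) (x x' y : lie_pres) :
  lp_lie (k *: x + x') y = k *: lp_lie x y + lp_lie x' y.
Proof.
elim/quotW: x => s; elim/quotW: x' => s'; elim/quotW: y => t.
by rewrite /GRing.scale /GRing.add /= (lp_scaleE k s) (lp_addE _ s') !lp_lieE
  lp_scaleE lp_addE; apply/clsP; constructor.
Qed.
Fact lp_linr (k : K) (x y y' : lie_pres) :
  lp_lie x (k *: y + y') = k *: lp_lie x y + lp_lie x y'.
Proof.
elim/quotW: x => s; elim/quotW: y => t; elim/quotW: y' => t'.
by rewrite /GRing.scale /GRing.add /= (lp_scaleE k t) (lp_addE _ t') !lp_lieE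
  lp_scaleE lp_addE; apply/clsP; constructor.
Qed.
Fact lp_alt (x : lie_pres) : lp_lie x x = 0.
Proof. by elim/quotW: x => s; rewrite lp_lieE; apply/clsP; constructor. Qed.
Fact lp_jacobi (x y z : lie_pres) :
  lp_lie x (lp_lie y z) + lp_lie y (lp_lie z x) + lp_lie z (lp_lie x y) = 0.
Proof.
elim/quotW: x => s; elim/quotW: y => t; elim/quotW: z => u.
by rewrite /GRing.add /= (lp_lieE t u) (lp_lieE u s) (lp_lieE s t) !lp_lieE
  (lp_addE (Tlie s _)) lp_addE; apply/clsP; constructor.
Qed.

HB.instance Definition _ := Lmodule_isLieAlgebra.Build K lie_pres
  lp_linl lp_linr lp_alt lp_jacobi.

Lemma cls0 : cls Tzero = 0. Proof. by []. Qed.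
Lemma clsD s t : cls (Tadd s t) = cls s + cls t.
Proof. exact/esym/lp_addE. Qed.
Lemma clsN s : cls (Topp s) = - cls s.
Proof. exact/esym/lp_oppE. Qed.
Lemma clsZ k s : cls (Tscale k s) = k *: cls s.
Proof. exact/esym/lp_scaleE. Qed.
Lemma clsL s t : cls (Tlie s t) = ⟦cls s, cls t⟧.
Proof. exact/esym/lp_lieE. Qed.

Fixpoint term_eval (L : lieAlgType K) (g : X -> L) (t : term) : L :=
  match t with
  | Tgen x => g x
  | Tzero => 0
  | Tadd s t => term_eval g s + term_eval g t
  | Topp s => - term_eval g s
  | Tscale k s => k *: term_eval g s
  | Tlie s t => ⟦term_eval g s, term_eval g t⟧
  end.

(* The homomorphism determined by its values g on the generators; meaningful
   when g is compatible with R (lp_liftE, lp_lift_hom). *)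
Definition lp_lift (L : lieAlgType K) (g : X -> L) (x : lie_pres) : L :=
  term_eval g (repr x).

Lemma term_eval_cong (L : lieAlgType K) (g : X -> L) :
  (forall s t, R s t -> term_eval g s = term_eval g t) ->
  forall s t, lie_cong R s t -> term_eval g s = term_eval g t.
Proof.
move=> gR s t; elim=> /=; clear s t; first exact: gR; try by move=> *; congruence.
- by move=> s t u; rewrite addrA.
- by move=> s t; rewrite addrC.
- by move=> t; rewrite add0r.
- by move=> t; rewrite addNr.
- by move=> k l t; rewrite scalerA.
- by move=> t; rewrite scale1r.
- by move=> k s t; rewrite scalerDr.
- by move=> k l t; rewrite scalerDl.
- by move=> k s s' t; rewrite lie_linearl.
- by move=> k s t t'; rewrite lie_linearr.
- by move=> t; rewrite liexx.
- by move=> s t u; rewrite lie_jacobi.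
Qed.

Lemma lp_lift_cls (L : lieAlgType K) (g : X -> L) :
  (forall s t, R s t -> term_eval g s = term_eval g t) ->
  forall t, lp_lift g (cls t) = term_eval g t.
Proof. by move=> gR t; apply: term_eval_cong => //; apply: repr_cls. Qed.

Lemma lp_lift_hom (L : lieAlgType K) (g : X -> L) :
  (forall s t, R s t -> term_eval g s = term_eval g t) ->
  lie_hom (lp_lift g).
Proof.
move=> gR; split=> [k|]; elim/quotW=> s; elim/quotW=> t.
  by rewrite -clsZ -clsD !lp_lift_cls.
by rewrite -clsL !lp_lift_cls.
Qed.

Fixpoint term_der (g : X -> lie_pres) (t : term) : lie_pres :=
  match t with
  | Tgen x => g x
  | Tzero => 0
  | Tadd s t => term_der g s + term_der g t
  | Topp s => - term_der g s
  | Tscale k s => k *: term_der g s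
  | Tlie s t => ⟦term_der g s, cls t⟧ + ⟦cls s, term_der g t⟧
  end.

(* The derivation determined by its values g on the generators; meaningful
   when term_der g is compatible with the congruence. *)
Definition lp_der (g : X -> lie_pres) (x : lie_pres) : lie_pres :=
  term_der g (repr x).

End Presentation.

(* The tensor product A (x) B; meaningful when ab and ba are Lie actions of A
   on B and of B on A. *)
Section Tensor.
Variables (K : fieldType) (A B : lieAlgType K).
Variables (ab : A -> B -> B) (ba : B -> A -> A).

Local Notation g a b := (Tgen (a, b)).

Inductive tensor_rel : lie_term K (A * B) -> lie_term K (A * B) -> Prop :=
  | Trel_linl k a a' b :
      tensor_rel (g (k *: a + a') b) (Tadd (Tscale k (g a b)) (g a' b))
  | Trel_linr k a b b' :
      tensor_rel (g a (k *: b + b')) (Tadd (Tscale k (g a b)) (g a b'))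
  | Trel_liel a a' b :
      tensor_rel (g ⟦a, a'⟧ b) (Tadd (g a (ab a' b)) (Topp (g a' (ab a b))))
  | Trel_lier a b b' :
      tensor_rel (g a ⟦b, b'⟧) (Tadd (g (ba b' a) b) (Topp (g (ba b a) b')))
  | Trel_lie a b a' b' :
      tensor_rel (Tlie (g a b) (g a' b')) (Topp (g (ba b a) (ab a' b'))).

Definition tensor : lieAlgType K := lie_pres tensor_rel.

Definition tens (a : A) (b : B) : tensor :=
  \pi_(lie_pres tensor_rel) (g a b).

Definition tensor_lift (L : lieAlgType K) (phi : A -> B -> L) : tensor -> L :=
  @lp_lift _ _ tensor_rel L (fun p => phi p.1 p.2).

Definition tensor_der (phi : A -> B -> tensor) : tensor -> tensor :=
  @lp_der _ _ tensor_rel (fun p => phi p.1 p.2).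

Lemma tens_bilin : bilin tens.
Proof.
split=> [b k a a'|a k b b'] /=.
  by rewrite -clsZ -clsD; apply/clsP/Crel/Trel_linl.
by rewrite -clsZ -clsD; apply/clsP/Crel/Trel_linr.
Qed.

Lemma tens_liel a a' b : tens ⟦a, a'⟧ b = tens a (ab a' b) - tens a' (ab a b).
Proof. by rewrite -clsN -clsD; apply/clsP/Crel/Trel_liel. Qed.

Lemma tens_lier a b b' : tens a ⟦b, b'⟧ = tens (ba b' a) b - tens (ba b a) b'.
Proof. by rewrite -clsN -clsD; apply/clsP/Crel/Trel_lier. Qed.

Lemma lie_tens a b a' b' :
  ⟦tens a b, tens a' b'⟧ = - tens (ba b a) (ab a' b').
Proof. by rewrite -clsN -clsL; apply/clsP/Crel/Trel_lie. Qed.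

Lemma tensor_ind (P : tensor -> Prop) :
  P 0 -> (forall k x y, P x -> P y -> P (k *: x + y)) ->
  (forall a b, P (tens a b)) -> forall x, P x.
Proof.
move=> P0 PD Pg x.
suff H : forall Q : tensor -> Prop, subspace Q -> (forall a b, Q (tens a b)) ->
    Q x by apply: H.
elim/quotW: x; elim=> [[a b]|||||].
- by move=> Q sQ; apply.
- by move=> Q [].
- move=> s IHs t IHt Q sQ Qg; rewrite clsD -[X in X + _]scale1r.
  by apply: sQ.2; [apply: IHs | apply: IHt].
- move=> s IHs Q sQ Qg; rewrite clsN -scaleN1r -[_ *: _]addr0.
  by apply: sQ.2; [apply: IHs | exact: sQ.1].
- move=> k s IHs Q sQ Qg; rewrite clsZ -[_ *: _]addr0.
  by apply: sQ.2; [apply: IHs | exact: sQ.1].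
- move=> s IHs t IHt Q sQ Qg; rewrite clsL.
  apply: (IHs (fun x => Q ⟦x, _⟧)) => [|a b].
    split=> [|k u v Qu Qv]; first by rewrite lie0l; case: sQ.
    by rewrite lie_linearl; apply: sQ.2.
  apply: (IHt (fun y => Q ⟦_, y⟧)) => [|a' b'].
    split=> [|k u v Qu Qv]; first by rewrite lie0r; case: sQ.
    by rewrite lie_linearr; apply: sQ.2.
  rewrite lie_tens -scaleN1r -[_ *: _]addr0.
  by apply: sQ.2; [apply: Qg | exact: sQ.1].
Qed.

Section Lift.
Variables (L : lieAlgType K) (phi : A -> B -> L).
Hypothesis phi_bilin : bilin phi.
Hypothesis phi_liel : forall a a' b,
  phi ⟦a, a'⟧ b = phi a (ab a' b) - phi a' (ab a b).
Hypothesis phi_lier : forall a b b',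
  phi a ⟦b, b'⟧ = phi (ba b' a) b - phi (ba b a) b'.
Hypothesis phi_lie : forall a b a' b',
  ⟦phi a b, phi a' b'⟧ = - phi (ba b a) (ab a' b').

Let phiR s t : tensor_rel s t ->
  term_eval (fun p => phi p.1 p.2) s = term_eval (fun p => phi p.1 p.2) t.
Proof.
case=> //= k *; last by rewrite (phi_bilin.2 _).
by rewrite (phi_bilin.1 _).
Qed.

Lemma tensor_lift_tens a b : tensor_lift phi (tens a b) = phi a b.
Proof. exact: (lp_lift_cls phiR). Qed.

Lemma tensor_lift_lie_hom : lie_hom (tensor_lift phi).
Proof. exact: lp_lift_hom phiR. Qed.
End Lift.

End Tensor.

Section CrossedModules.
Variable K : fieldType.

Record lie_action (N M : lieAlgType K) (act : N -> M -> M) : Prop := {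
  act_bilin : bilin act;
  act_lie : forall n n' m, act ⟦n, n'⟧ m = act n (act n' m) - act n' (act n m);
  act_der : forall n m m', act n ⟦m, m'⟧ = ⟦act n m, m'⟧ + ⟦m, act n m'⟧
}.

Lemma adjoint_action (L : lieAlgType K) : lie_action (@lie K L).
Proof.
split; [exact: lie_bilin | exact: lie_der |] => x y z.
by rewrite (lie_der x y z) subrK.
Qed.

Record is_crossed_module (M N : lieAlgType K) (bd : M -> N) (act : N -> M -> M)
    : Prop := {
  cm_action : lie_action act;
  cm_hom : lie_hom bd;
  cm_equiv : forall n m, bd (act n m) = ⟦n, bd m⟧;
  cm_peiffer : forall m m', act (bd m) m' = ⟦m, m'⟧
}.

Record is_braiding (M N : lieAlgType K) (bd : M -> N) (act : N -> M -> M)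
    (br : N -> N -> M) : Prop := {
  br_bilin : bilin br;
  br_bd : forall n n', bd (br n n') = ⟦n, n'⟧;
  br_bdbd : forall m m', br (bd m) (bd m') = ⟦m, m'⟧;
  br_bdl : forall m n, br (bd m) n = - act n m;
  br_bdr : forall m n, br n (bd m) = act n m;
  br_lier : forall n n' n'', br n ⟦n', n''⟧ = br ⟦n, n'⟧ n'' - br ⟦n, n''⟧ n';
  br_liel : forall n n' n'', br ⟦n, n'⟧ n'' = br n ⟦n', n''⟧ - br n' ⟦n, n''⟧
}.

Record crossed_module := CrossedModule {
  cm_top : lieAlgType K;
  cm_base : lieAlgType K;
  cm_bd : cm_top -> cm_base;
  cm_act : cm_base -> cm_top -> cm_top;
  crossed_moduleP : is_crossed_module cm_bd cm_act
}.

Record braided_crossed_module := BraidedCrossedModule {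
  bcm_cm :> crossed_module;
  bcm_br : cm_base bcm_cm -> cm_base bcm_cm -> cm_top bcm_cm;
  braidingP : is_braiding (@cm_bd bcm_cm) (@cm_act bcm_cm) bcm_br
}.

Record cm_morphism (X Y : crossed_module)
    (f1 : cm_top X -> cm_top Y) (f2 : cm_base X -> cm_base Y) : Prop := {
  cmm_hom1 : lie_hom f1;
  cmm_hom2 : lie_hom f2;
  cmm_act : forall n m, f1 (cm_act n m) = cm_act (f2 n) (f1 m);
  cmm_bd : forall m, cm_bd (f1 m) = f2 (cm_bd m)
}.

Record bcm_morphism (X Y : braided_crossed_module)
    (f1 : cm_top X -> cm_top Y) (f2 : cm_base X -> cm_base Y) : Prop := {
  bcmm_cm : @cm_morphism X Y f1 f2;
  bcmm_br : forall n n', f1 (bcm_br n n') = bcm_br (f2 n) (f2 n')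
}.

(* M^N *)
Definition cm_invariant (X : crossed_module) (m : cm_top X) : Prop :=
  forall n : cm_base X, cm_act n m = 0.

(* st_N(M) *)
Definition cm_stabilizer (X : crossed_module) (n : cm_base X) : Prop :=
  forall m : cm_top X, cm_act n m = 0.

(* D_N(M) *)
Definition cm_displacement (X : crossed_module) : cm_top X -> Prop :=
  lie_subalgebra_gen (fun x => exists n m, x = @cm_act X n m).

Definition perfect_cm (X : crossed_module) : Prop :=
  (forall m : cm_top X, cm_displacement m) /\
  (forall n : cm_base X, derived n).

(* The extension (f1, f2), with domain X, is to be central as an extension of
   crossed modules. *)
Record compatible_central_extension (X Y : braided_crossed_module)
    (f1 : cm_top X -> cm_top Y) (f2 : cm_base X -> cm_base Y) : Prop := {
  cce_morphism : bcm_morphism f1 f2;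
  cce_surj1 : forall y, exists x, f1 x = y;
  cce_surj2 : forall y, exists x, f2 x = y;
  cce_ker1 : forall m, f1 m = 0 -> cm_invariant m;
  cce_ker2 : forall n, f2 n = 0 -> cm_stabilizer n /\ lie_center n
}.

End CrossedModules.

Section TensorCrossedModule.
Variables (K : fieldType) (X : crossed_module K).
Local Notation M := (cm_top X).
Local Notation N := (cm_base X).
Local Notation bd := (@cm_bd K X).
Local Notation act := (@cm_act K X).
Implicit Types (m : M) (n p : N).

Definition top_act (m : M) (n : N) : N := ⟦bd m, n⟧.

(* N (x) N and N (x) M *)
Definition tensorNN : lieAlgType K := tensor (@lie K N) (@lie K N).
Definition tensorNM : lieAlgType K := tensor act top_act.
Definition tensNN (n n' : N) : tensorNN := tens (@lie K N) (@lie K N) n n'.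
Definition tensNM (n : N) (m : M) : tensorNM := tens act top_act n m.

(* n (x) m |-> n . m *)
Definition can1 : tensorNM -> M :=
  tensor_lift (ab := act) (ba := top_act) act.

(* n (x) n' |-> [n, n'] *)
Definition can2 : tensorNN -> N :=
  tensor_lift (ab := @lie K N) (ba := @lie K N) (@lie K N).

(* Id_N (x) bd *)
Definition tensor_bd : tensorNM -> tensorNN :=
  tensor_lift (ab := act) (ba := top_act) (fun n m => tensNN n (bd m)).

(* each p in N acts on N (x) M as the derivation
   n (x) m |-> [p, n] (x) m + n (x) (p . m),
   and x in N (x) N acts as can2 x does *)
Definition tensor_act (x : tensorNN) : tensorNM -> tensorNM :=
  tensor_der (ab := act) (ba := top_act)
    (fun n m => tensNM ⟦can2 x, n⟧ m + tensNM n (act (can2 x) m)).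

Let XP := crossed_moduleP X.
Let aP := cm_action XP.
Let bdh := cm_hom XP.

Lemma top_act_action : lie_action top_act.
Proof.
have adj := adjoint_action N; rewrite /top_act; split.
- split=> [n k m m'|m k n n']; first by rewrite bdh.1 lie_linearl.
  exact: lie_linearr.
- by move=> m m' n; rewrite bdh.2; apply: act_lie adj _ _ _.
- by move=> m n n'; apply: act_der adj _ _ _.
Qed.

Lemma tensNM_bilin : bilin tensNM. Proof. exact: tens_bilin. Qed.
Lemma tensNN_bilin : bilin tensNN. Proof. exact: tens_bilin. Qed.

Lemma can1_pairing :
  [/\ bilin act,
      forall n n' m, act ⟦n, n'⟧ m = act n (act n' m) - act n' (act n m),
      forall n m m', act n ⟦m, m'⟧ = act (top_act m' n) m - act (top_act m n) m'
    & forall n m n' m',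
        ⟦act n m, act n' m'⟧ = - act (top_act m n) (act n' m')].
Proof.
have top n m m' : act (top_act m n) m' = - ⟦act n m, m'⟧.
  rewrite /top_act lieC (linrN ((act_bilin aP).1 _)) -(cm_equiv XP).
  by rewrite (cm_peiffer XP).
split; [exact: act_bilin | exact: act_lie | |].
- move=> n m m'; rewrite !top opprK (act_der aP) [RHS]addrC.
  by rewrite -(lieC m).
- by move=> n m n' m'; rewrite top opprK.
Qed.

Lemma can1_tens n m : can1 (tensNM n m) = act n m.
Proof. by case: can1_pairing => *; apply: tensor_lift_tens. Qed.
Lemma can1_lie_hom : lie_hom can1.
Proof. by case: can1_pairing => *; apply: tensor_lift_lie_hom. Qed.

Lemma lie_lier n n' n'' : ⟦n, ⟦n', n''⟧⟧ = ⟦⟦n'', n⟧, n'⟧ - ⟦⟦n', n⟧, n''⟧ :> N.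
Proof.
rewrite lieC lie_der opprB (lieC n' ⟦n'', n⟧) (lieC n'' ⟦n', n⟧).
by rewrite opprK addrC.
Qed.

Lemma lie_lie n p n' p' : ⟦⟦n, p⟧, ⟦n', p'⟧⟧ = - ⟦⟦p, n⟧, ⟦n', p'⟧⟧ :> N.
Proof. by rewrite -lieNl -lieC. Qed.

Lemma can2_tens n n' : can2 (tensNN n n') = ⟦n, n'⟧.
Proof.
apply: tensor_lift_tens; [exact: lie_bilin | exact: lie_der | exact: lie_lier |
  exact: lie_lie].
Qed.
Lemma can2_lie_hom : lie_hom can2.
Proof.
apply: tensor_lift_lie_hom; [exact: lie_bilin | exact: lie_der |
  exact: lie_lier | exact: lie_lie].
Qed.

Lemma tensor_bd_pairing :
  let phi n m := tensNN n (bd m) in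
  [/\ bilin phi,
      forall n n' m, phi ⟦n, n'⟧ m = phi n (act n' m) - phi n' (act n m),
      forall n m m', phi n ⟦m, m'⟧ = phi (top_act m' n) m - phi (top_act m n) m'
    & forall n m n' m',
        ⟦phi n m, phi n' m'⟧ = - phi (top_act m n) (act n' m')].
Proof.
split=> *; rewrite ?(cm_equiv XP).
- split=> [m k n n'|n k m m']; first by rewrite (tensNN_bilin.1 _).
  by rewrite (bdh.1) (tensNN_bilin.2 _).
- exact: tens_liel.
- by rewrite bdh.2; apply: tens_lier.
- exact: lie_tens.
Qed.

Lemma tensor_bd_tens n m : tensor_bd (tensNM n m) = tensNN n (bd m).
Proof.
by case: tensor_bd_pairing => *;
   apply: (tensor_lift_tens (phi := fun n m => tensNN n (bd m))).
Qed.
Lemma tensor_bd_lie_hom : lie_hom tensor_bd.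
Proof. by case: tensor_bd_pairing => *; apply: tensor_lift_lie_hom. Qed.

Lemma can2_tensor_bd y : can2 (tensor_bd y) = bd (can1 y).
Proof.
elim/tensor_ind: y => [|k x y IHx IHy|n m].
- by rewrite (linr0 tensor_bd_lie_hom.1) (linr0 can2_lie_hom.1)
     (linr0 can1_lie_hom.1) (linr0 bdh.1).
- by rewrite tensor_bd_lie_hom.1 can2_lie_hom.1 can1_lie_hom.1 bdh.1 IHx IHy.
- by rewrite tensor_bd_tens can2_tens can1_tens (cm_equiv XP).
Qed.

Lemma bilin_tensl p : linear (fun m => tensNM p m).
Proof. exact: tensNM_bilin.2. Qed.

Lemma lie_tensNM p q y : ⟦tensNM p q, y⟧ = - tensNM ⟦bd q, p⟧ (can1 y).
Proof.
elim/tensor_ind: y => [|k x y IHx IHy|n m].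
- by rewrite lie0r (linr0 can1_lie_hom.1) (linr0 (tensNM_bilin.2 _)) oppr0.
- by rewrite lie_linearr can1_lie_hom.1 (tensNM_bilin.2 _) IHx IHy
     scalerN opprD.
- by rewrite can1_tens; apply: lie_tens.
Qed.

Lemma tensNM_der p n m :
  tensNM ⟦p, n⟧ m + tensNM n (act p m) = tensNM p (act n m).
Proof. by rewrite /tensNM tens_liel subrK. Qed.

Lemma term_der_tensNM p t :
  term_der (R := tensor_rel act top_act)
    (fun q => tensNM ⟦p, q.1⟧ q.2 + tensNM q.1 (act p q.2)) t =
  tensNM p (can1 (\pi_(lie_pres (tensor_rel act top_act)) t)).
Proof.
have lc := can1_lie_hom.1; have lt := tensNM_bilin.2 p.
elim: t => /= [[n m]|||||].
- by rewrite /= tensNM_der -can1_tens.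
- by rewrite cls0 (linr0 lc) (linr0 lt).
- by move=> s -> t ->; rewrite clsD (linrD lc) (linrD lt).
- by move=> s ->; rewrite clsN (linrN lc) (linrN lt).
- by move=> k s ->; rewrite clsZ (linrZ lc) (linrZ lt).
- move=> s -> t ->; rewrite clsL can1_lie_hom.2 [X in _ + X]lieC !lie_tensNM.
  rewrite opprK addrC [RHS]tens_lier.
  by [].
Qed.

Lemma tensor_actE x y : tensor_act x y = tensNM (can2 x) (can1 y).
Proof. by rewrite /tensor_act /tensor_der /lp_der term_der_tensNM reprK. Qed.

Lemma tensor_act_tens n n' n'' m :
  tensor_act (tensNN n n') (tensNM n'' m) =
  tensNM ⟦⟦n, n'⟧, n''⟧ m + tensNM n'' (act ⟦n, n'⟧ m).
Proof. by rewrite tensor_actE can2_tens can1_tens tensNM_der. Qed.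

Lemma can1_tensor_act x y : can1 (tensor_act x y) = act (can2 x) (can1 y).
Proof. by rewrite tensor_actE can1_tens. Qed.

Lemma lie_tensorNN x y : ⟦x, y⟧ = tensNN (can2 x) (can2 y).
Proof.
elim/tensor_ind: x => [|k x x' IHx IHx'|n m].
- by rewrite lie0l (linr0 can2_lie_hom.1) (linr0 (tensNN_bilin.1 _)).
- by rewrite lie_linearl can2_lie_hom.1 (tensNN_bilin.1 _) IHx IHx'.
elim/tensor_ind: y => [|k x x' IHx IHx'|n' m'].
- by rewrite lie0r (linr0 can2_lie_hom.1) (linr0 (tensNN_bilin.2 _)).
- by rewrite lie_linearr can2_lie_hom.1 (tensNN_bilin.2 _) IHx IHx'.
rewrite lie_tens !can2_tens (lieC n m) (linrN (tensNN_bilin.1 _)).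
by [].
Qed.

Lemma lie_tensorNM x y : ⟦x, y⟧ = tensNM (bd (can1 x)) (can1 y).
Proof.
elim/tensor_ind: x => [|k x x' IHx IHx'|n m].
- by rewrite lie0l (linr0 can1_lie_hom.1) (linr0 bdh.1)
     (linr0 (tensNM_bilin.1 _)).
- by rewrite lie_linearl can1_lie_hom.1 bdh.1 (tensNM_bilin.1 _) IHx IHx'.
by rewrite lie_tensNM can1_tens (cm_equiv XP) (lieC n)
  (linrN (tensNM_bilin.1 _)).
Qed.

Lemma tensor_is_crossed_module : is_crossed_module tensor_bd tensor_act.
Proof.
split; last 2 first.
- move=> x y; rewrite tensor_actE tensor_bd_tens lie_tensorNN.
  by rewrite can2_tensor_bd.
- by move=> y y'; rewrite tensor_actE can2_tensor_bd lie_tensorNM.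
- split.
  + split=> [y k x x'|x k y y']; rewrite !tensor_actE.
      by rewrite can2_lie_hom.1 (tensNM_bilin.1 _).
    by rewrite can1_lie_hom.1 (tensNM_bilin.2 _).
  + move=> x x' y; rewrite !tensor_actE !can1_tens can2_lie_hom.2.
    exact: tens_liel.
  + move=> x y y'; rewrite !tensor_actE can1_lie_hom.2.
    rewrite [X in _ = _ + X]lieC !lie_tensNM opprK addrC.
    exact: tens_lier.
- exact: tensor_bd_lie_hom.
Qed.

Definition tensor_cm : crossed_module K :=
  CrossedModule tensor_is_crossed_module.

End TensorCrossedModule.

Section TensorBraided.
Variables (K : fieldType) (X : braided_crossed_module K).
Local Notation M := (cm_top X).
Local Notation N := (cm_base X).
Local Notation bd := (@cm_bd K X).
Local Notation act := (@cm_act K X).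
Local Notation br := (@bcm_br K X).

(* n (x) n' |-> {n, n'} *)
Definition tensor_br1 : tensorNN X -> M :=
  tensor_lift (ab := @lie K N) (ba := @lie K N) br.

(* n (x) n', n'' (x) n''' |-> [n, n'] (x) {n'', n'''} *)
Definition tensor_br (x y : tensorNN X) : tensorNM X :=
  tensNM (can2 x) (tensor_br1 y).

Let XP := crossed_moduleP X.
Let aP := cm_action XP.
Let bdh := cm_hom XP.
Let bP := braidingP X.

Lemma tensor_br1_pairing :
  [/\ bilin br,
      forall n n' n'', br ⟦n, n'⟧ n'' = br n ⟦n', n''⟧ - br n' ⟦n, n''⟧,
      forall n n' n'', br n ⟦n', n''⟧ = br ⟦n'', n⟧ n' - br ⟦n', n⟧ n''
    & forall n m n' m', ⟦br n m, br n' m'⟧ = - br ⟦m, n⟧ ⟦n', m'⟧].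
Proof.
have brN n n' n'' : br ⟦n, n'⟧ n'' = - br ⟦n', n⟧ n''.
  by rewrite lieC (linrN ((br_bilin bP).1 _)).
split; [exact: (br_bilin bP) | exact: (br_liel bP) | |].
- by move=> n n' n''; rewrite (br_lier bP) (brN n n') (brN n n'') opprK addrC.
- by move=> n m n' m'; rewrite -(br_bdbd bP) !(br_bd bP) brN.
Qed.

Lemma tensor_br1_tens n n' : tensor_br1 (tensNN n n') = br n n'.
Proof. by case: tensor_br1_pairing => *; apply: tensor_lift_tens. Qed.
Lemma tensor_br1_lie_hom : lie_hom tensor_br1.
Proof. by case: tensor_br1_pairing => *; apply: tensor_lift_lie_hom. Qed.

Lemma tensor_br_tens n n' n'' n''' :
  tensor_br (tensNN n n') (tensNN n'' n''') = tensNM ⟦n, n'⟧ (br n'' n''').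
Proof. by rewrite /tensor_br can2_tens tensor_br1_tens. Qed.

Lemma bd_tensor_br1 x : bd (tensor_br1 x) = can2 x.
Proof.
elim/tensor_ind: x => [|k x y IHx IHy|n m].
- by rewrite (linr0 tensor_br1_lie_hom.1) (linr0 bdh.1) (linr0 (can2_lie_hom X).1).
- by rewrite tensor_br1_lie_hom.1 bdh.1 (can2_lie_hom X).1 IHx IHy.
- by rewrite tensor_br1_tens can2_tens (br_bd bP).
Qed.

Lemma tensor_br1_bd y : tensor_br1 (tensor_bd y) = can1 y.
Proof.
elim/tensor_ind: y => [|k x y IHx IHy|n m].
- by rewrite (linr0 (tensor_bd_lie_hom X).1) (linr0 tensor_br1_lie_hom.1)
     (linr0 (can1_lie_hom X).1).
- by rewrite (tensor_bd_lie_hom X).1 tensor_br1_lie_hom.1 (can1_lie_hom X).1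
     IHx IHy.
- by rewrite tensor_bd_tens tensor_br1_tens can1_tens (br_bdr bP).
Qed.

Lemma tens_bd_can1 (q : M) (y : tensorNM X) :
  tensNM (bd (can1 y)) q = - tensNM (bd q) (can1 y).
Proof.
have lt := (tensNM_bilin X).1.
elim/tensor_ind: y => [|k x y IHx IHy|n m].
- by rewrite (linr0 (can1_lie_hom X).1) (linr0 bdh.1) (linr0 (lt _))
     (linr0 ((tensNM_bilin X).2 _)) oppr0.
- by rewrite (can1_lie_hom X).1 bdh.1 (lt _) ((tensNM_bilin X).2 _)
     IHx IHy scalerN opprD.
rewrite can1_tens (cm_equiv XP).
have H1 := @tens_liel _ _ _ act (@top_act K X) n (bd m) q.
have H2 := @tens_lier _ _ _ act (@top_act K X) n m q.
have H3 := @tens_liel _ _ _ act (@top_act K X) (bd q) n m.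
rewrite -!/(tensNM _ _) !(cm_peiffer XP) in H1 H2 H3 *.
have H4 : tensNM (bd m) (act n q) = tensNM (top_act q n) m.
  move: H1; rewrite H2 /top_act (lieC n) (linrN (lt _)) addrAC -[LHS]add0r.
  by move=> /addIr /eqP; rewrite eq_sym subr_eq0 => /eqP.
rewrite H1 H4 /top_act H3 (lieC q m) (linrN ((tensNM_bilin X).2 _)).
by rewrite opprK opprD addrCA subrr addr0.
Qed.

Lemma tensor_is_braiding :
  is_braiding (@cm_bd K (tensor_cm X)) (@cm_act K (tensor_cm X)) tensor_br.
Proof.
split=> /=.
- split=> [y k x x'|x k y y']; rewrite /tensor_br.
    by rewrite (can2_lie_hom X).1 ((tensNM_bilin X).1 _).
  by rewrite tensor_br1_lie_hom.1 ((tensNM_bilin X).2 _).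
- by move=> x y; rewrite /tensor_br tensor_bd_tens bd_tensor_br1 lie_tensorNN.
- by move=> y y'; rewrite /tensor_br can2_tensor_bd tensor_br1_bd lie_tensorNM.
- move=> y x; rewrite /tensor_br can2_tensor_bd tens_bd_can1 bd_tensor_br1.
  by rewrite tensor_actE.
- by move=> y x; rewrite /tensor_br tensor_br1_bd tensor_actE.
- move=> x y z; rewrite /tensor_br tensor_br1_lie_hom.2 !(can2_lie_hom X).2.
  rewrite [LHS]tens_lier /top_act !bd_tensor_br1.
  rewrite (lieC (can2 z)) (lieC (can2 y)) -!/(tensNM _ _).
  by rewrite !(linrN ((tensNM_bilin X).1 _)) opprK addrC.
- move=> x y z; rewrite /tensor_br !tensor_br1_lie_hom.2 (can2_lie_hom X).2.
  by rewrite [LHS]tens_liel -!bd_tensor_br1 !(cm_peiffer XP).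
Qed.

Definition tensor_bcm : braided_crossed_module K :=
  BraidedCrossedModule tensor_is_braiding.

End TensorBraided.

Arguments cm_morphism {K} X Y f1 f2.
Arguments bcm_morphism {K} X Y f1 f2.
Arguments compatible_central_extension {K} X Y f1 f2.
Arguments can1 {K} X _.
Arguments can2 {K} X _.

(* Main.v *)
(** If [f : Y -> X] is central, then [y . x] and [[y, y']] in [Y] only depend on
    the images of their arguments under [f].  Choosing preimages therefore gives
    well-defined pairings [N x M -> X_1] and [N x N -> X_2], which inherit all
    the tensor relations from [Y] by surjectivity of [f]; they induce [h].
    Conversely, since [X] is perfect, [c] is surjective, so every generator of
    the tensor products is [x * y] or [[x, y]] for some [x], [y] in [V], and its
    image in [Y] is forced. *)

Require Import Defs.
From HB Require Import structures.
From mathcomp Require Import all_boot all_algebra.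
From mathcomp Require Import boolp.

Set Implicit Arguments.
Unset Strict Implicit.
Unset Printing Implicit Defensive.

Import GRing.Theory.
Local Open Scope ring_scope.

(** A bracket of two pure tensors is again a pure tensor up to sign, so pure tensors span the tensor
    product as a vector space and linearity alone suffices. *)
Lemma tensor_linear_ext (K : fieldType) (A B : lieAlgType K)
    (ab : A -> B -> B) (ba : B -> A -> A) (V : lmodType K)
    (g h : tensor ab ba -> V) :
  linear g -> linear h -> (forall a b, g (tens ab ba a b) = h (tens ab ba a b)) ->
  g =1 h.
Proof.
move=> lg lh gh; elim/tensor_ind => [|k x y IHx IHy|//].
  by rewrite (linr0 lg) (linr0 lh).
by rewrite lg lh IHx IHy.
Qed.

Lemma linear_comp (K : fieldType) (U V W : lmodType K) (f : V -> W) (g : U -> V) :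
  linear f -> linear g -> linear (f \o g).
Proof. by move=> lf lg k u v; rewrite /= lg lf. Qed.

Lemma lie_hom_image_subalgebra (K : fieldType) (L L' : lieAlgType K)
    (f : L -> L') :
  lie_hom f -> lie_subalgebra (fun y => exists x, f x = y).
Proof.
move=> [lf mf]; split; first split.
- by exists 0; rewrite (linr0 lf).
- by move=> k _ _ [u <-] [v <-]; exists (k *: u + v); rewrite lf.
- by move=> _ _ [u <-] [v <-]; exists ⟦u, v⟧; rewrite mf.
Qed.

(** * Surjectivity of [c] *)

Section Perfect.
Variables (K : fieldType) (X : crossed_module K).
Hypothesis X_perfect : perfect_cm X.

(** The image of [can1] is a Lie subalgebra containing every [n . m], hence all of [D_N(M)]. *)
Lemma can1_surj m : exists y, can1 X y = m.
Proof.
apply: ((X_perfect.1 m) (fun m => exists y, can1 X y = m)).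
  exact: (lie_hom_image_subalgebra (can1_lie_hom X)).
by move=> _ [n [p ->]]; exists (tensNM n p); rewrite can1_tens.
Qed.

Lemma can2_surj n : exists x, can2 X x = n.
Proof.
apply: ((X_perfect.2 n) (fun n => exists x, can2 X x = n)).
  exact: (lie_hom_image_subalgebra (can2_lie_hom X)).1.
by move=> p q; exists (tensNN p q); rewrite can2_tens.
Qed.

End Perfect.

(** Centrality holds because the action on [N (x) M] and the bracket of [N (x) N] factor through
    [can1] and [can2]; perfection gives surjectivity. *)
Lemma can_compatible_central_extension (K : fieldType)
    (X : braided_crossed_module K) :
  perfect_cm X -> compatible_central_extension (tensor_bcm X) X (can1 X) (can2 X).
Proof.
move=> Xp; split.
- split; first split.
  + exact: can1_lie_hom.
  + exact: can2_lie_hom.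
  + exact: can1_tensor_act.
  + by move=> y; rewrite /= can2_tensor_bd.
  (* Since [n . m = {n, bd m}] and [bd (tensor_br1 y) = can2 y], the image of the braiding is
     [{can2 x, can2 y}]. *)
  + move=> x y; rewrite /= /tensor_br can1_tens -(br_bdr (braidingP X)).
    by rewrite bd_tensor_br1.
- exact: can1_surj.
- exact: can2_surj.
- by move=> y y0 x; rewrite /= tensor_actE y0 (linr0 ((tensNM_bilin X).2 _)).
- move=> x x0; split=> y.
    by rewrite /= tensor_actE x0 (linr0 ((tensNM_bilin X).1 _)).
  by rewrite lie_tensorNN x0 (linr0 ((tensNN_bilin X).1 _)).
Qed.

(** * Existence and uniqueness of [h] *)

Section Universal.
Variables (K : fieldType) (X Y : braided_crossed_module K).
Variables (f1 : cm_top Y -> cm_top X) (f2 : cm_base Y -> cm_base X).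
Hypothesis f_cce : compatible_central_extension Y X f1 f2.

Let fm := bcmm_cm (cce_morphism f_cce).
Let f1h := cmm_hom1 fm.
Let f2h := cmm_hom2 fm.
Let aY := cm_action (crossed_moduleP Y).

(** A mere set-theoretic section; centrality later makes the choice, and its lack of linearity,
    harmless. *)
Definition preim1 m : cm_top Y := sval (cid (cce_surj1 f_cce m)).
Definition preim2 n : cm_base Y := sval (cid (cce_surj2 f_cce n)).

Lemma preim1K : cancel preim1 f1.
Proof. by move=> m; rewrite /preim1; case: cid. Qed.
Lemma preim2K : cancel preim2 f2.
Proof. by move=> n; rewrite /preim2; case: cid. Qed.

Definition lift_act n m : cm_top Y := cm_act (preim2 n) (preim1 m).
Definition lift_lie n n' : cm_base Y := ⟦preim2 n, preim2 n'⟧.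

Lemma act_eq_of_image y y' x x' :
  f2 y = f2 y' -> f1 x = f1 x' -> @cm_act K Y y x = cm_act y' x'.
Proof.
(* One argument is changed at a time: [x - x'] is invariant, and [y - y'] stabilizes the top
   algebra. *)
move=> fy fx; apply: (etrans (y := cm_act y x')).
  apply/eqP; rewrite -subr_eq0 -(linrB ((act_bilin aY).2 y)); apply/eqP.
  by apply: (cce_ker1 f_cce); rewrite (linrB f1h.1) fx subrr.
apply/eqP; rewrite -subr_eq0 -(linrB ((act_bilin aY).1 x')); apply/eqP.
have/(cce_ker2 f_cce)[] : f2 (y - y') = 0 by rewrite (linrB f2h.1) fy subrr.
exact.
Qed.

Lemma lie_eq_of_image y y' z z' :
  f2 y = f2 y' -> f2 z = f2 z' -> ⟦y, z⟧ = ⟦y', z'⟧.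
Proof.
have eql u v w : f2 u = f2 v -> ⟦u, w⟧ = ⟦v, w⟧.
  move=> fuv; apply/eqP; rewrite -subr_eq0 -(linrB ((lie_bilin _).1 w)).
  apply/eqP; have/(cce_ker2 f_cce)[_] : f2 (u - v) = 0.
    by rewrite (linrB f2h.1) fuv subrr.
  exact.
by move=> /eql -> /eql fz; rewrite lieC fz -lieC.
Qed.

Lemma lift_actE y x : lift_act (f2 y) (f1 x) = cm_act y x.
Proof. by apply: act_eq_of_image; rewrite ?preim1K ?preim2K. Qed.

Lemma lift_lieE y y' : lift_lie (f2 y) (f2 y') = ⟦y, y'⟧.
Proof. by apply: lie_eq_of_image; rewrite ?preim2K. Qed.

Lemma morph_top_act x y : f2 (top_act x y) = top_act (f1 x) (f2 y).
Proof. by rewrite /top_act f2h.2 (cmm_bd fm). Qed.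

(** Every argument is written as the image of its chosen preimage and [f] is pulled outside;
    [lift_actE] then reduces each identity to one already known in [Y]. *)
Lemma lift_act_pairing :
  [/\ bilin lift_act,
      forall n n' m, lift_act ⟦n, n'⟧ m =
        lift_act n (cm_act n' m) - lift_act n' (cm_act n m),
      forall n m m', lift_act n ⟦m, m'⟧ =
        lift_act (top_act m' n) m - lift_act (top_act m n) m'
    & forall n m n' m', ⟦lift_act n m, lift_act n' m'⟧ =
        - lift_act (top_act m n) (cm_act n' m')].
Proof.
have [_ p2 p3 p4] := can1_pairing Y.
split; first split.
- move=> m k n n'; rewrite -(preim1K m) -(preim2K n) -(preim2K n') -f2h.1.
  by rewrite !lift_actE ((act_bilin aY).1 _).
- move=> n k m m'; rewrite -(preim2K n) -(preim1K m) -(preim1K m') -f1h.1.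
  by rewrite !lift_actE ((act_bilin aY).2 _).
- move=> n n' m; rewrite -(preim2K n) -(preim2K n') -(preim1K m) -f2h.2.
  by rewrite -!(cmm_act fm) !lift_actE p2.
- move=> n m m'; rewrite -(preim2K n) -(preim1K m) -(preim1K m') -f1h.2.
  by rewrite -!morph_top_act !lift_actE p3.
- move=> n m n' m'; rewrite -(preim2K n) -(preim1K m) -(preim2K n') -(preim1K m').
  by rewrite -morph_top_act -(cmm_act fm) !lift_actE p4.
Qed.

Lemma lift_lie_pairing :
  [/\ bilin lift_lie,
      forall n n' n'', lift_lie ⟦n, n'⟧ n'' =
        lift_lie n ⟦n', n''⟧ - lift_lie n' ⟦n, n''⟧,
      forall n n' n'', lift_lie n ⟦n', n''⟧ =
        lift_lie ⟦n'', n⟧ n' - lift_lie ⟦n', n⟧ n''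
    & forall n p n' p', ⟦lift_lie n p, lift_lie n' p'⟧ =
        - lift_lie ⟦p, n⟧ ⟦n', p'⟧].
Proof.
split; first split.
- move=> p k n n'; rewrite -(preim2K p) -(preim2K n) -(preim2K n') -f2h.1.
  by rewrite !lift_lieE lie_linearl.
- move=> p k n n'; rewrite -(preim2K p) -(preim2K n) -(preim2K n') -f2h.1.
  by rewrite !lift_lieE lie_linearr.
- move=> n n' n''; rewrite -(preim2K n) -(preim2K n') -(preim2K n'') -!f2h.2.
  by rewrite !lift_lieE lie_der.
- move=> n n' n''; rewrite -(preim2K n) -(preim2K n') -(preim2K n'') -!f2h.2.
  by rewrite !lift_lieE lie_lier.
- move=> n p n' p'; rewrite -(preim2K n) -(preim2K p) -(preim2K n') -(preim2K p').
  by rewrite -!f2h.2 !lift_lieE lie_lie.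
Qed.

Definition univ1 : tensorNM X -> cm_top Y :=
  tensor_lift (ab := @cm_act K X) (ba := @top_act K X) lift_act.
Definition univ2 : tensorNN X -> cm_base Y :=
  tensor_lift (ab := @lie K (cm_base X)) (ba := @lie K (cm_base X)) lift_lie.

Lemma univ1_tens n m : univ1 (tensNM n m) = lift_act n m.
Proof. by case: lift_act_pairing => *; apply: tensor_lift_tens. Qed.
Lemma univ1_lie_hom : lie_hom univ1.
Proof. by case: lift_act_pairing => *; apply: tensor_lift_lie_hom. Qed.
Lemma univ2_tens n n' : univ2 (tensNN n n') = lift_lie n n'.
Proof. by case: lift_lie_pairing => *; apply: tensor_lift_tens. Qed.
Lemma univ2_lie_hom : lie_hom univ2.
Proof. by case: lift_lie_pairing => *; apply: tensor_lift_lie_hom. Qed.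

Lemma univ1_factor : can1 X =1 f1 \o univ1.
Proof.
apply: tensor_linear_ext; first exact: (can1_lie_hom X).1.
  exact: linear_comp f1h.1 univ1_lie_hom.1.
move=> n m; rewrite -!/(tensNM _ _) can1_tens /= univ1_tens (cmm_act fm).
by rewrite preim1K preim2K.
Qed.

Lemma univ2_factor : can2 X =1 f2 \o univ2.
Proof.
apply: tensor_linear_ext; first exact: (can2_lie_hom X).1.
  exact: linear_comp f2h.1 univ2_lie_hom.1.
by move=> n n'; rewrite -!/(tensNN _ _) can2_tens /= univ2_tens f2h.2 !preim2K.
Qed.

Lemma univ_cm_morphism : cm_morphism (tensor_cm X) Y univ1 univ2.
Proof.
have bdY := cm_hom (crossed_moduleP Y).
split; [exact: univ1_lie_hom | exact: univ2_lie_hom | |].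
(* The action of [x] on [y] is the pure tensor of [can2 x] and [can1 y], whose preimages may be
   taken to be [univ2 x] and [univ1 y]. *)
- move=> x y; rewrite /= tensor_actE univ1_tens univ1_factor univ2_factor.
  exact: lift_actE.
- apply: tensor_linear_ext; first exact: linear_comp bdY.1 univ1_lie_hom.1.
    exact: linear_comp univ2_lie_hom.1 (tensor_bd_lie_hom X).1.
  move=> n m; rewrite -!/(tensNM _ _) /= univ1_tens tensor_bd_tens univ2_tens.
  rewrite (cm_equiv (crossed_moduleP Y)).
  (* Both [bd (preim1 m)] and [preim2 (bd m)] lie over [bd m]. *)
  by apply: lie_eq_of_image; rewrite // -(cmm_bd fm) preim1K preim2K.
Qed.

Lemma univ_bcm_morphism : bcm_morphism (tensor_bcm X) Y univ1 univ2.
Proof.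
have bY := braidingP Y; split; first exact: univ_cm_morphism.
move=> x; rewrite /= /tensor_br.
apply: tensor_linear_ext.
- apply: (linear_comp univ1_lie_hom.1); apply: (linear_comp (f := tensNM _)).
    exact: (tensNM_bilin X).2.
  exact: (tensor_br1_lie_hom X).1.
- exact: linear_comp ((br_bilin bY).2 _) univ2_lie_hom.1.
move=> n n'; rewrite -!/(tensNN _ _) tensor_br1_tens univ1_tens univ2_tens.
(* In [Y] the bracket of the preimages is the boundary of their braiding, so braiding with it is an
   action, which depends only on images in [X]. *)
rewrite /lift_lie -(br_bd bY) (br_bdr bY) -lift_actE univ2_factor.
by rewrite (bcmm_br (cce_morphism f_cce)) !preim2K.
Qed.

(** No compatibility with braidings is assumed of [g1], [g2], so this serves both the braided and
    the non-braided uniqueness claims. *)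
Lemma univ_unique g1 g2 :
  perfect_cm X -> cm_morphism (tensor_cm X) Y g1 g2 ->
  can1 X =1 f1 \o g1 -> can2 X =1 f2 \o g2 -> g1 =1 univ1 /\ g2 =1 univ2.
Proof.
move=> Xp gm g1f g2f; split; apply: tensor_linear_ext.
- exact: (cmm_hom1 gm).1.
- exact: univ1_lie_hom.1.
(* The generator is now [x] acting on [y], so [g1] sends it to [g2 x] acting on [g1 y], which is
   determined by [can2 x] and [can1 y]. *)
- move=> n m; have [x <-] := can2_surj Xp n; have [y <-] := can1_surj Xp m.
  rewrite -!/(tensNM _ _) univ1_tens -tensor_actE (cmm_act gm) g1f g2f.
  by rewrite lift_actE.
- exact: (cmm_hom2 gm).1.
- exact: univ2_lie_hom.1.
- move=> n n'; have [x <-] := can2_surj Xp n; have [y <-] := can2_surj Xp n'.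
  rewrite -!/(tensNN _ _) univ2_tens -lie_tensorNN (cmm_hom2 gm).2 !g2f.
  by rewrite lift_lieE.
Qed.

End Universal.

Theorem proposition3p3 (K : fieldType) (X : braided_crossed_module K)
    (X_perfect : perfect_cm X) :
  compatible_central_extension (tensor_bcm X) X (can1 X) (can2 X) /\
  forall (Y : braided_crossed_module K)
         (f1 : cm_top Y -> cm_top X) (f2 : cm_base Y -> cm_base X),
    compatible_central_extension Y X f1 f2 ->
    exists (h1 : cm_top (tensor_bcm X) -> cm_top Y)
           (h2 : cm_base (tensor_bcm X) -> cm_base Y),
      [/\ bcm_morphism (tensor_bcm X) Y h1 h2,
          can1 X =1 f1 \o h1 /\ can2 X =1 f2 \o h2,
          (forall (g1 : cm_top (tensor_bcm X) -> cm_top Y)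
                  (g2 : cm_base (tensor_bcm X) -> cm_base Y),
            bcm_morphism (tensor_bcm X) Y g1 g2 ->
            can1 X =1 f1 \o g1 -> can2 X =1 f2 \o g2 ->
            g1 =1 h1 /\ g2 =1 h2)
        & (cm_morphism (tensor_cm X) Y h1 h2 /\
          forall (g1 : cm_top (tensor_cm X) -> cm_top Y)
                 (g2 : cm_base (tensor_cm X) -> cm_base Y),
            cm_morphism (tensor_cm X) Y g1 g2 ->
            can1 X =1 f1 \o g1 -> can2 X =1 f2 \o g2 ->
            g1 =1 h1 /\ g2 =1 h2)].
Proof.
split=> [|Y f1 f2 f_cce]; first exact: can_compatible_central_extension.
exists (univ1 f_cce), (univ2 f_cce); split.
- exact: univ_bcm_morphism.
- by split; [exact: univ1_factor | exact: univ2_factor].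
(* Forgetting the braiding reduces this to uniqueness among morphisms of crossed modules. *)
- by move=> g1 g2 /bcmm_cm; apply: univ_unique.
- by split=> [|g1 g2]; [exact: univ_cm_morphism | apply: univ_unique].
Qed.
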